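(* Let $R$ be a ring, let $\delta$ be an expansion function of ideals of $R$, and let $I$ be a weakly $\delta$-semiprimary ideal of $R$. Suppose that $\{0\} \neq AB \subseteq I$ for some ideals $A, B$ of $R$. Then $A \subseteq \delta(I)$ or $B \subseteq \delta(I)$ (i.e., $I$ is a strongly weakly $\delta$-semiprimary ideal of $R$).
   Context: All rings are commutative with $1 \neq 0$. $I(R)$ denotes the set of all ideals of $R$ (including $R$ itself); an ideal $I$ is proper if $I \neq R$. A function $\delta : I(R) \to I(R)$ is an expansion function of ideals of $R$ if $L \subseteq \delta(L)$ for every ideal $L$ of $R$, and $\delta(J) \subseteq \delta(I)$ whenever $J \subseteq I$ are ideals of $R$. A proper ideal $I$ of $R$ is weakly $\delta$-semiprimary if whenever $a,b\in R$ and $0 \neq ab \in I$, then $a \in \delta(I)$ or $b \in \delta(I)$. A proper ideal $I$ of $R$ is strongly weakly $\delta$-semiprimary if whenever $\{0\} \neq AB \subseteq I$ for some ideals $A,B$ of $R$, then $A \subseteq \delta(I)$ or $B \subseteq \delta(I)$. $AB$ is the usual product of ideals. *)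

(* Defs.v *)
From mathcomp Require Import all_boot all_algebra.
From mathcomp Require Import boolp classical_sets.

Set Implicit Arguments.
Unset Strict Implicit.
Unset Printing Implicit Defensive.

Import GRing.Theory.

Local Open Scope classical_set_scope.
Local Open Scope ring_scope.

(* MathComp's [idealr_closed] is restricted to proper ideals with boolean
   membership; here I(R) must contain R itself, so ideals are bundled
   [Prop]-valued sets. *)
Record ideal (R : comNzRingType) := Ideal {
  ideal_set :> set R;
  ideal0 : ideal_set 0;
  idealD : forall x y, ideal_set x -> ideal_set y -> ideal_set (x + y);
  idealM : forall r x, ideal_set x -> ideal_set (r * x)
}.

Definition is_proper (R : comNzRingType) (I : ideal R) : Prop :=
  (I : set R) <> setT.

Definition mul_set (R : comNzRingType) (A B : ideal R) : set R :=
  [set x | exists2 s : seq (R * R),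
     (forall p, p \in s -> ideal_set A p.1 /\ ideal_set B p.2)
     & x = \sum_(p <- s) p.1 * p.2].

Lemma mul_set0 (R : comNzRingType) (A B : ideal R) : mul_set A B 0.
Proof. by exists [::] => //; rewrite big_nil. Qed.

Lemma mul_setD (R : comNzRingType) (A B : ideal R) x y :
  mul_set A B x -> mul_set A B y -> mul_set A B (x + y).
Proof.
move=> [s sAB ->] [t tAB ->]; exists (s ++ t); last by rewrite big_cat.
by move=> p; rewrite mem_cat => /orP[/sAB|/tAB].
Qed.

Lemma mul_setM (R : comNzRingType) (A B : ideal R) r x :
  mul_set A B x -> mul_set A B (r * x).
Proof.
move=> [s sAB ->]; exists [seq (r * p.1, p.2) | p <- s].
  by move=> _ /mapP[p /sAB[Ap Bp] ->]; split=> //=; apply: idealM.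
by rewrite big_map mulr_sumr; apply: eq_bigr => p _; rewrite mulrA.
Qed.

Definition ideal_mul (R : comNzRingType) (A B : ideal R) : ideal R :=
  Ideal (@mul_set0 R A B) (@mul_setD R A B) (@mul_setM R A B).

Definition expansion_function (R : comNzRingType)
    (delta : ideal R -> ideal R) : Prop :=
  (forall L : ideal R, L `<=` delta L) /\
  (forall I J : ideal R, J `<=` I -> delta J `<=` delta I).

Definition weakly_delta_semiprimary (R : comNzRingType)
    (delta : ideal R -> ideal R) (I : ideal R) : Prop :=
  is_proper I /\
  forall a b : R, a * b <> 0 -> ideal_set I (a * b) ->
    ideal_set (delta I) a \/ ideal_set (delta I) b.

Definition strongly_weakly_delta_semiprimary (R : comNzRingType)
    (delta : ideal R -> ideal R) (I : ideal R) : Prop :=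
  is_proper I /\
  forall A B : ideal R,
    (ideal_mul A B : set R) <> [set 0] -> ideal_mul A B `<=` I ->
    A `<=` delta I \/ B `<=` delta I.

(* Main.v *)
Require Import Defs.
From mathcomp Require Import all_boot all_algebra.
From mathcomp Require Import boolp classical_sets.

Local Open Scope classical_set_scope.
Local Open Scope ring_scope.

(** Write [D] for [delta I], and suppose that neither [A] nor [B] is contained
    in [D]. If [a] in [A] and [b] in [B] both lie outside [D], then [a * b]
    lies in [I], so the weak semiprimary condition forces [a * b = 0]. Elements
    outside [D] are enough to control everything: an ideal that is not
    contained in [D] is additively generated by its elements outside [D]
    ([ideal_ind_outside]). Since multiplication is biadditive, [a * b = 0]
    then holds for all [a] in [A] and [b] in [B], so [A B = 0]. *)

Import GRing.Theory.

(** If [c] in [J] is outside [D], then every [x] in both [J] and [D] is the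
    difference of [x + c] and [c], two elements of [J] outside [D]. *)
Lemma ideal_ind_outside (R : comNzRingType) (J D : ideal R) (P : R -> Prop) :
  ~ J `<=` D ->
  (forall x y, P x -> P y -> P (x - y)) ->
  (forall x, ideal_set J x -> ~ ideal_set D x -> P x) ->
  forall x, ideal_set J x -> P x.
Proof.
move=> /existsNP[c /not_implyP[Jc NDc]] PB Pout x Jx.
have [Dx|NDx] := pselect (ideal_set D x); last exact: Pout.
rewrite -(addrK c x); apply: PB; apply: Pout => //; first exact: idealD.
move=> Dxc; apply: NDc; rewrite -(addKr x c) -mulN1r.
by apply: idealD => //; apply: idealM.
Qed.

Lemma ideal_mul_eq0 (R : comNzRingType) (A B : ideal R) :
  (forall a b, ideal_set A a -> ideal_set B b -> a * b = 0) ->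
  (ideal_mul A B : set R) = [set 0].
Proof.
move=> AB0; apply/seteqP; split=> [x [s sAB ->]|x ->]; last exact: ideal0.
by apply: big1_seq => p /= /sAB[Ap Bp]; apply: AB0.
Qed.

Lemma ideal_mul_mem (R : comNzRingType) (A B : ideal R) a b :
  ideal_set A a -> ideal_set B b -> ideal_set (ideal_mul A B) (a * b).
Proof.
move=> Aa Bb; exists [:: (a, b)]; last by rewrite big_seq1.
by move=> p; rewrite inE => /eqP->.
Qed.

Lemma weakly_delta_semiprimary_ideals (R : comNzRingType)
    (delta : ideal R -> ideal R) (I A B : ideal R) :
  weakly_delta_semiprimary delta I ->
  (ideal_mul A B : set R) <> [set 0] -> ideal_mul A B `<=` I ->
  A `<=` delta I \/ B `<=` delta I.
Proof.
move=> [_ wI] ABn0 ABI; apply: contrapT => /not_orP[NA NB].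
apply: ABn0; apply: ideal_mul_eq0 => a b Aa Bb; move: a Aa.
apply: (ideal_ind_outside _ _ _ (fun a => a * b = 0) NA) => [x y xb0 yb0|a Aa NDa].
  by rewrite mulrBl xb0 yb0 subrr.
move: b Bb.
apply: (ideal_ind_outside _ _ _ (fun b => a * b = 0) NB) => [x y ax0 ay0|b Bb NDb].
  by rewrite mulrBr ax0 ay0 subrr.
apply: contrapT => abn0.
by have [] := wI a b abn0 (ABI _ (ideal_mul_mem _ _ _ _ _ Aa Bb)).
Qed.

Theorem theorem5p4 (R : comNzRingType) (delta : ideal R -> ideal R)
    (I : ideal R) (hdelta : expansion_function delta)
    (hI : weakly_delta_semiprimary delta I) :
  (forall A B : ideal R,
     (ideal_mul A B : set R) <> [set 0] -> ideal_mul A B `<=` I ->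
     A `<=` delta I \/ B `<=` delta I)
  /\ strongly_weakly_delta_semiprimary delta I.
Proof.
have sI A B := @weakly_delta_semiprimary_ideals R delta I A B hI.
by split=> //; split=> //; case: hI.
Qed.
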